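(* Let $k\ge0$, $n>2k$ and $0\le m\le\lfloor(n-2k)/2\rfloor$. For $z^n\in\mathcal Z^n$ let $\hat{\mathbf S}_{k,m}(z^n)=(\hat\sigma_{k+1},\dots,\hat\sigma_{n-k})$ be any minimizer of $\tilde L_{\mathbf S}(z^n)$ over $\mathbf S\in\mathcal S^n_{k,m}(z^n)$. Then for all $\epsilon>0$ and all $x^n\in\mathcal X^n$, $$\Pr\Big(L_{\hat{\mathbf S}_{k,m}(Z^n)}(x_{k+1}^{n-k},Z^n)-D_{k,m}(x^n,Z^n)>\epsilon\Big)\le 2(k+1)\exp\Bigg(-(n-2k)\Big[\frac{\epsilon^2}{2(k+1)L_{\max}^2}-2|\mathcal Z|^{2k}\Big\{h\Big(\frac{m}{n-2k}\Big)+\frac{(m+1)\ln N}{n-2k}\Big\}\Big]\Bigg),$$ where $h(x)=-x\ln x-(1-x)\ln(1-x)$ and $N=|\mathcal S|$.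
   Context: Let $\mathcal X,\mathcal Z,\hat{\mathcal X}$ be finite alphabets and $\Pi=\{\Pi(x,z)\}$ a $|\mathcal X|\times|\mathcal Z|$ stochastic matrix (discrete memoryless channel) of full row rank. For deterministic $x^n\in\mathcal X^n$, the channel output $Z^n$ has independent components with $\Pr(Z_t=z)=\Pi(x_t,z)$. Fix a loss $\Lambda:\mathcal X\times\hat{\mathcal X}\to[0,\infty)$, $\Lambda_{\max}=\max_{x,\hat x}\Lambda(x,\hat x)$. Let $\mathcal S$ be the set of all maps $s:\mathcal Z\to\hat{\mathcal X}$. Fix a real $|\mathcal Z|\times|\mathcal X|$ matrix $H$ with $\Pi H=I$; $h(z)\in\mathbb R^{\mathcal X}$ is the column vector equal to the $z$-th row of $H$. For $s\in\mathcal S$, $\rho_x(s)=\sum_z\Lambda(x,s(z))\Pi(x,z)$ and $\ell(z,s)=h(z)^T\rho(s)$. Let $\ell_{\max}=\max_{z,s}\ell(z,s)-\min_{z,s}\ell(z,s)$, $L_{\max}=\Lambda_{\max}+\ell_{\max}$. For $z^n$ and $k+1\le t\le n-k$ let $\mathbf c_t=(z_{t-k}^{t-1},z_{t+1}^{t+k})\in\mathcal Z^{2k}$, and for $\mathbf c\in\mathcal Z^{2k}$ let $\mathcal T(\mathbf c)=\{t:k+1\le t\le n-k,\ \mathbf c_t=\mathbf c\}$. Define $\mathcal S^n_{k,m}(z^n)$ as the set of tuples $\mathbf S=(\sigma_{k+1},\dots,\sigma_{n-k})\in\mathcal S^{n-2k}$ such that for every $\mathbf c\in\mathcal Z^{2k}$,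 writing $\mathcal T(\mathbf c)=\{\tau_1<\dots<\tau_r\}$, the number of $j<r$ with $\sigma_{\tau_j}\ne\sigma_{\tau_{j+1}}$ is at most $m$. For such $\mathbf S$ let $L_{\mathbf S}(x_{k+1}^{n-k},z^n)=\frac1{n-2k}\sum_{t=k+1}^{n-k}\Lambda(x_t,\sigma_t(z_t))$ and $\tilde L_{\mathbf S}(z^n)=\frac1{n-2k}\sum_{t=k+1}^{n-k}\ell(z_t,\sigma_t)$, and let $D_{k,m}(x^n,z^n)=\min_{\mathbf S\in\mathcal S^n_{k,m}(z^n)}L_{\mathbf S}(x_{k+1}^{n-k},z^n)$. *)

(* Defs.v *)
From HB Require Import structures.
From mathcomp Require Import all_boot all_order all_algebra.
From mathcomp Require Import reals sequences exp.
From mathcomp Require Import zify.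
Set Implicit Arguments. Unset Strict Implicit. Unset Printing Implicit Defensive.
Import Order.TTheory GRing.Theory Num.Theory.
Local Open Scope ring_scope.

(* Positions are 0-based: the paper's time t (1-based, k+1 <= t <= n-k)
   corresponds to the index j : 'I_(n-2k) with 0-based position k + j in 'I_n. *)
Lemma pos_lt (n k : nat) (j : 'I_(n - 2 * k)) : (k + j < n)%N.
Proof. have := ltn_ord j. lia. Qed.
Definition pos (n k : nat) (j : 'I_(n - 2 * k)) : 'I_n := Ordinal (pos_lt j).

(* i-th coordinate (i < 2k) of the context c_t = (z_{t-k}^{t-1}, z_{t+1}^{t+k}):
   0-based position j + i if i < k, and j + i + 1 if i >= k. *)
Lemma cpos_lt (n k : nat) (j : 'I_(n - 2 * k)) (i : 'I_(2 * k)) :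
  (j + i + (k <= i) < n)%N.
Proof. have := ltn_ord j; have := ltn_ord i; case: (k <= i)%N => /=; lia. Qed.
Definition cpos (n k : nat) (j : 'I_(n - 2 * k)) (i : 'I_(2 * k)) : 'I_n :=
  Ordinal (cpos_lt j i).

Section Defs.
Variables (R : realType) (X Z Xh : finType).
Variables (Pi : X -> Z -> R) (Lam : X -> Xh -> R) (H : Z -> X -> R).

Definition rho (x : X) (s : {ffun Z -> Xh}) : R := \sum_z Lam x (s z) * Pi x z.
Definition ell (z : Z) (s : {ffun Z -> Xh}) : R := \sum_x H z x * rho x s.

(* Lambda_max = max Lambda (Lambda >= 0, so the default 0 is harmless);
   ell_max = max ell - min ell = max over pairs of differences (which include 0). *)
Definition Lam_max : R := \big[Num.max/0]_(p : X * Xh) Lam p.1 p.2.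
Definition ell_max : R :=
  \big[Num.max/0]_(p : (Z * {ffun Z -> Xh}) * (Z * {ffun Z -> Xh}))
     (ell p.1.1 p.1.2 - ell p.2.1 p.2.2).
Definition L_max : R := Lam_max + ell_max.

Variables (n k m : nat).

Definition ctx (z : {ffun 'I_n -> Z}) (j : 'I_(n - 2 * k)) : {ffun 'I_(2 * k) -> Z} :=
  [ffun i => z (cpos j i)].

Definition nswitch (s : seq {ffun Z -> Xh}) : nat :=
  if s is a :: s' then count id (pairmap (fun u v => u != v) a s') else 0%N.

Definition admissible (z : {ffun 'I_n -> Z})
    (Sg : {ffun 'I_(n - 2 * k) -> {ffun Z -> Xh}}) : bool :=
  [forall c : {ffun 'I_(2 * k) -> Z},
     (nswitch [seq Sg j | j <- enum 'I_(n - 2 * k) & ctx z j == c] <= m)%N].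

Definition Lhat (x : 'I_n -> X) (z : {ffun 'I_n -> Z})
    (Sg : {ffun 'I_(n - 2 * k) -> {ffun Z -> Xh}}) : R :=
  ((n - 2 * k)%N%:R)^-1 * \sum_(j < n - 2 * k) Lam (x (pos j)) (Sg j (z (pos j))).

Definition Ltil (z : {ffun 'I_n -> Z})
    (Sg : {ffun 'I_(n - 2 * k) -> {ffun Z -> Xh}}) : R :=
  ((n - 2 * k)%N%:R)^-1 * \sum_(j < n - 2 * k) ell (z (pos j)) (Sg j).

(* D_{k,m}: min over admissible S of Lhat; the default Lam_max is an upper bound
   of every Lhat (an average of Lambda values), so the min is exact whenever the
   admissible set is nonempty (it always is: constant tuples are admissible). *)
Definition Dkm (x : 'I_n -> X) (z : {ffun 'I_n -> Z}) : R :=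
  \big[Num.min/Lam_max]_(Sg | admissible z Sg) Lhat x z Sg.

Definition Pr (x : 'I_n -> X) (E : pred {ffun 'I_n -> Z}) : R :=
  \sum_(z | E z) \prod_(t < n) Pi (x t) (z t).

End Defs.

(* binary entropy in nats (ln 0 = 0 in MathComp-Analysis, so 0 ln 0 = 0) *)
Definition hb (R : realType) (x : R) : R := - x * ln x - (1 - x) * ln (1 - x).

(* Main.v *)
(* For each fixed rule [s] the estimated loss [ell (Z_t) s] is an unbiased
   estimate of the true loss [Lam (x t) (s (Z_t))], and if the minimiser of the
   estimated loss is worse than the best rule by [eps], some admissible tuple has
   an estimation error exceeding [eps / 2] in one of the two directions. Split
   the positions into the [k + 1] residue classes modulo [k + 1]. No context of a
   position involves another position of the same class, so given the symbols
   outside a class its contexts are determined and its symbols remain independent.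
   Within a class, Hoeffding's bound applies to each tuple and is summed over all
   tuples with weight [y] per switch; with [y = p / ((1 - p) * N)], [p = m / T],
   the sum of the weights is governed by the entropy [hb p]. *)

Require Import Defs.
From mathcomp Require Import all_boot all_order all_algebra.
From mathcomp Require Import reals sequences exp.
From mathcomp Require Import topology normedtype derive realfun.
From mathcomp Require Import zify ring lra.
Set Implicit Arguments. Unset Strict Implicit. Unset Printing Implicit Defensive.
Import Order.TTheory GRing.Theory Num.Theory numFieldNormedType.Exports.
Local Open Scope ring_scope.

(** * Hoeffding's lemma for a finite distribution *)

Lemma ge0_is_derive_le (R : realType) (f f' : R -> R) (u : R) :
  (forall v : R, is_derive v 1 f (f' v)) -> (forall v, 0 <= v -> 0 <= f' v) ->
  0 <= u -> f 0 <= f u.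
Proof.
move=> df f'0 u0.
have [c /andP[c0 _] e] : exists2 c, c \in `[0, u]%R & f u - f 0 = f' c * (u - 0).
  apply: MVT_segment => //.
  apply: continuous_subspaceT => v; apply: differentiable_continuous.
  exact/derivable1_diffP/ex_derive.
by rewrite -subr_ge0 e subr0 mulr_ge0 ?f'0.
Qed.

(** The logarithm of the left side has as second derivative the variance of a tilted Bernoulli
    variable, at most 1/4. Integrate twice from 0, where [F] and [F'] vanish. *)
Lemma bernoulli_mgf_le (R : realType) (p u : R) : 0 <= p <= 1 -> 0 <= u ->
  (1 - p) * expR (- (p * u)) + p * expR ((1 - p) * u) <= expR (u ^+ 2 / 8).
Proof.
move=> /andP[p0 p1] u0.
pose g (v : R) : R := 1 - p + p * expR v.
have g_gt0 v : 0 < g v.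
  have [e0|pN0] := eqVneq p 0; first by rewrite /g e0; lra.
  rewrite ltr_wpDl ?subr_ge0// mulr_gt0 ?expR_gt0//.
  by rewrite lt_neqAle eq_sym pN0.
have dg (v : R) : is_derive v 1 g (p * expR v).
  by apply: is_derive_eq; rewrite /GRing.scale /=; ring.
pose F (v : R) : R := v ^+ 2 / 8 + p * v - ln (g v).
pose F' (v : R) : R := v / 4 + p - p * expR v * (g v)^-1.
have dF (v : R) : is_derive v 1 F (F' v).
  have := is_derive1_comp (is_derive1_ln (g_gt0 v)) (dg v).
  move=> dl; apply: is_derive_eq.
  by rewrite /F' /GRing.scale /=; field; exact: lt0r_neq0.
have dF' (v : R) : is_derive v 1 F' (4^-1 - p * expR v * (1 - p) / (g v) ^+ 2).
  have gN0 := lt0r_neq0 (g_gt0 v).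
  have dgV := is_deriveV gN0 (dg v).
  apply: is_derive_eq.
  have -> : 1 - p = g v - p * expR v by rewrite /g addrK.
  by rewrite /GRing.scale /=; field.
have F'_ge0 v : 0 <= v -> 0 <= F' v.
  move=> v0; have -> : 0 = F' 0 by rewrite /F' /g expR0; field; lra.
  apply: ge0_is_derive_le dF' _ v0 => w _; have := g_gt0 w; rewrite /g => gw.
  rewrite subr_ge0 ler_pdivrMr ?exprn_gt0//.
  (* This square is AM-GM for the two summands of [g w]. *)
  have := sqr_ge0 (1 - p - p * expR w); nra.
have : F 0 <= F u by apply: ge0_is_derive_le dF F'_ge0 u0.
rewrite /F /g expR0 mulr0 expr2 !mul0r mulr1 subrK ln1 subr0 add0r subr_ge0 => Fu.
have -> : (1 - p) * expR (- (p * u)) + p * expR ((1 - p) * u) =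
    expR (- (p * u)) * g u.
  rewrite (_ : (1 - p) * u = - (p * u) + u); last by ring.
  by rewrite expRD /g; ring.
by rewrite -{1}[g u]lnK ?posrE// -expRD ler_expR; move: Fu; rewrite /g expr2; lra.
Qed.

(** Convexity, from the tangent line at the barycentre [c]. *)
Lemma expR_chord (R : realType) (a b w : R) : 0 <= w <= 1 ->
  expR (w * a + (1 - w) * b) <= w * expR a + (1 - w) * expR b.
Proof.
move=> /andP[w0 w1]; set c := w * a + (1 - w) * b.
have tangent t : expR c * (1 + (t - c)) <= expR t.
  rewrite (_ : expR t = expR c * expR (t - c)); last by rewrite -expRD subrKC.
  by rewrite ler_pM2l ?expR_gt0 ?expR_ge1Dx.
have -> : expR c = w * (expR c * (1 + (a - c))) + (1 - w) * (expR c * (1 + (b - c))).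
  by rewrite {3 5}/c; ring.
by apply: lerD; apply: ler_wpM2l => //; rewrite subr_ge0.
Qed.

(** By convexity the extreme case is the mean-zero law on the endpoints of an interval of length
    [L], a centred Bernoulli variable scaled by [L]. *)
Lemma hoeffding_mgf_le (R : realType) (Z : finType) (mu f : Z -> R) (L lam : R) :
  (forall z, 0 <= mu z) -> \sum_z mu z = 1 -> \sum_z mu z * f z = 0 ->
  (forall z z', f z - f z' <= L) -> 0 < L -> 0 <= lam ->
  \sum_z mu z * expR (lam * f z) <= expR (lam ^+ 2 * L ^+ 2 / 8).
Proof.
move=> mu0 mu1 mean0 fL L0 lam0.
have [z1 _|Z0] := pickP Z; last first.
  by move: mu1; rewrite big_pred0 // => /eqP; rewrite eq_sym oner_eq0.
have [z0 f0] : exists z0, forall z, f z0 <= f z.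
  by exists [arg min_(z < z1) f z]%O; case: arg_minP => // z _ h z'; apply: h.
set a := f z0 in f0.
have sum_affine c d : \sum_z mu z * (c + d * f z) = c.
  under eq_bigr do rewrite mulrDr mulrCA [mu _ * c]mulrC.
  by rewrite big_split/= -!mulr_sumr mu1 mean0 mulr0 addr0 mulr1.
have a_le0 : a <= 0.
  rewrite -[leLHS](sum_affine a 0) -[leRHS]mean0; apply: ler_sum => z _.
  by rewrite mul0r addr0 ler_wpM2l.
have La_ge0 : 0 <= L + a.
  rewrite -[leRHS](sum_affine (L + a) 0) -[leLHS]mean0; apply: ler_sum => z _.
  by rewrite mul0r addr0 ler_wpM2l// -lerBlDr fL.
have LN0 := lt0r_neq0 L0.
(* The mass at [a + L] of the mean-zero law on [a] and [a + L]. *)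
set p := - a / L.
have p01 : 0 <= p <= 1.
  apply/andP; split; first by rewrite divr_ge0 ?oppr_ge0 // ltW.
  by rewrite ler_pdivrMr ?mul1r //; lra.
have := bernoulli_mgf_le p01 (mulr_ge0 lam0 (ltW L0)).
rewrite exprMn; apply: le_trans.
(* The chord of [expR] from [lam * a] to [lam * (a + L)] is affine in [f z],
   so its mean only sees the mean of [f]. *)
pose c := (1 - p) * expR (- (p * (lam * L))) + p * expR ((1 - p) * (lam * L)).
rewrite -/c -[leRHS](sum_affine c ((expR (lam * (a + L)) - expR (lam * a)) / L)).
apply: ler_sum => z _; apply: ler_wpM2l => //.
have w01 : 0 <= 1 - (f z - a) / L <= 1.
  rewrite subr_ge0 ler_pdivrMr // mul1r fL lerBlDr lerDl.
  by rewrite divr_ge0 ?subr_ge0// ltW.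
have := expR_chord (lam * a) (lam * (a + L)) w01.
rewrite (_ : _ + _ = lam * f z); last by field.
move=> /le_trans -> //; rewrite le_eqVlt; apply/orP; left; apply/eqP.
rewrite /c (_ : - (p * (lam * L)) = lam * a); last by rewrite /p; field.
rewrite (_ : (1 - p) * (lam * L) = lam * (a + L)); last by rewrite /p; field.
by rewrite /p; field.
Qed.


(** * Product weights *)

Section Update.
Variables (I Z : finType).

Definition upd (z : {ffun I -> Z}) (t : I) (a : Z) : {ffun I -> Z} :=
  [ffun i => if i == t then a else z i].

Lemma upd_same z t a : upd z t a t = a.
Proof. by rewrite ffunE eqxx. Qed.

Lemma upd_other z t a i : i != t -> upd z t a i = z i.
Proof. by move=> /negbTE it; rewrite ffunE it. Qed.

Lemma updK z t a : upd (upd z t a) t (z t) = z.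
Proof. by apply/ffunP => i; rewrite !ffunE; case: eqP => // ->. Qed.

(* Swapping the coordinate [z t] with an independent copy [a] preserves the product weight. *)
Lemma sum_prod_upd (R : comNzRingType) (mu : I -> Z -> R) t (F : {ffun I -> Z} -> R) :
  \sum_(z : {ffun I -> Z}) (\prod_i mu i (z i)) * (\sum_a mu t a * F (upd z t a)) =
  (\sum_a mu t a) * \sum_(z : {ffun I -> Z}) (\prod_i mu i (z i)) * F z.
Proof.
under eq_bigr do rewrite mulr_sumr.
rewrite pair_big/= mulrC mulr_suml.
under [RHS]eq_bigr do rewrite mulr_sumr.
rewrite [RHS]pair_big/=.
pose h (p : {ffun I -> Z} * Z) := (upd p.1 t p.2, p.1 t).
have hK : involutive h by case=> z a; rewrite /h/= updK upd_same.
rewrite [RHS](reindex_inj (inv_inj hK)); apply: eq_bigr => -[z a] _ /=.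
rewrite (bigD1 t)//= [in RHS](bigD1 t)//= upd_same.
under [in RHS]eq_bigr => i it do rewrite upd_other//.
by ring.
Qed.

(** The coordinates of the block are resampled one at a time: each enters a single factor [phi] and
    leaves [g] unchanged. This replaces conditioning on the symbols outside the block. *)
Lemma sum_prod_indep_le (R : realDomainType) (mu : I -> Z -> R) (J : eqType)
    (tau : J -> I) (phi : J -> Z -> R) (g : {ffun I -> Z} -> R) (B : R) (l : seq J) :
  (forall i a, 0 <= mu i a) -> (forall i, \sum_a mu i a = 1) ->
  injective tau -> (forall j a, 0 <= phi j a) ->
  (forall j, \sum_a mu (tau j) a * phi j a <= B) ->
  (forall z, 0 <= g z) -> (forall z j a, g (upd z (tau j) a) = g z) -> uniq l ->
  \sum_(z : {ffun I -> Z}) (\prod_i mu i (z i)) * (g z * \prod_(j <- l) phi j (z (tau j))) <=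
  B ^+ size l * \sum_(z : {ffun I -> Z}) (\prod_i mu i (z i)) * g z.
Proof.
move=> mu0 mu1 tau_inj phi0 phiB g0 g_upd.
have w0 (z : {ffun I -> Z}) : 0 <= \prod_i mu i (z i) by apply: prodr_ge0.
elim: l => [|j l IHl] /=.
  by rewrite mul1r => _; under eq_bigr do rewrite big_nil mulr1.
move=> /andP[jl ul].
have B0 : 0 <= B.
  by apply: le_trans (phiB j); apply: sumr_ge0 => a _; rewrite mulr_ge0.
have := sum_prod_upd mu (tau j)
  (fun z => g z * \prod_(i <- j :: l) phi i (z (tau i))).
rewrite mu1 mul1r => <-; rewrite exprS -mulrA.
apply: le_trans (ler_wpM2l B0 (IHl ul)); rewrite mulr_sumr.
apply: ler_sum => z _; rewrite mulrCA ler_wpM2l//.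
set G := \prod_(_ <- l) _.
have G_upd a : \prod_(i <- l) phi i (upd z (tau j) a (tau i)) = G.
  apply: eq_big_seq => i il; rewrite upd_other// (inj_eq tau_inj).
  by apply: contraNneq jl => <-.
rewrite (_ : \sum_a _ = g z * G * \sum_a mu (tau j) a * phi j a); last first.
  rewrite mulr_sumr; apply: eq_bigr => a _.
  by rewrite big_cons g_upd upd_same G_upd; ring.
by rewrite [leRHS]mulrC ler_wpM2l// mulr_ge0// /G prodr_ge0.
Qed.
End Update.

(** * Weighted counting of tuples with few switches *)

Section Switches.
Variables (R : realType) (Z Xh C : finType).
Local Notation S := {ffun Z -> Xh}.
Local Notation N := (#|{ffun Z -> Xh}|%:R : R).

(** A rule [a] in force before the first entry lets the count obey a one-step recursion. *)
Definition nswitch_from (a : S) (s : seq S) : nat :=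
  count id (pairmap (fun u v => u != v) a s).

Lemma nswitch_le_from a s : (nswitch s <= nswitch_from a s)%N.
Proof. by case: s => //= b s; rewrite leq_addl. Qed.

Lemma nswitch_from_trans a b s :
  (nswitch_from a s <= (a != b) + nswitch_from b s)%N.
Proof.
case: s => //= c s; rewrite /nswitch_from/= addnA leq_add2r.
by case: (eqVneq a b) => [->|]//=; case: (a != c).
Qed.

(** Disequality satisfies the triangle inequality, so deleting an entry creates no switch. Hence
    admissibility passes from all positions to one residue class. *)
Lemma nswitch_subseq (s1 s2 : seq S) : subseq s1 s2 -> (nswitch s1 <= nswitch s2)%N.
Proof.
have H a u v : subseq u v -> (nswitch_from a u <= nswitch_from a v)%N.
  elim: v u a => [|b v IHv] [|c u] a //= uv.
  have [cb|cb] := eqVneq c b; last first.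
    apply: leq_trans (nswitch_from_trans a b (c :: u)) _.
    rewrite leq_add2l; apply: IHv.
    by move: uv; rewrite (negbTE cb).
  by move: uv; rewrite cb eqxx /nswitch_from/= leq_add2l; apply: IHv.
elim: s2 s1 => [|b s2 IHs] [|c s1] //=; case: eqP => [-> /(H b)|_ /IHs] //.
by move=> /leq_trans -> //; apply: nswitch_le_from.
Qed.

Variables (y : R) (y0 : 0 <= y).

(** The state [sg] records the rule last used in each context, so one pass through [l] charges every
    switch and positions can be summed out one by one. *)
Fixpoint switch_weight (J : finType) (kap : J -> C) (sg : {ffun C -> S})
    (l : seq J) (Sg : {ffun J -> S}) : R :=
  if l is j :: l' then
    y ^+ (sg (kap j) != Sg j) * switch_weight kap (upd sg (kap j) (Sg j)) l' Sg
  else 1.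

Lemma switch_weightE (J : finType) (kap : J -> C) sg l Sg :
  switch_weight kap sg l Sg =
  \prod_c y ^+ nswitch_from (sg c) [seq Sg j | j <- l & kap j == c].
Proof.
elim: l sg => [|j l IHl] sg /=; first by rewrite big1.
rewrite IHl (bigD1 (kap j))//= [RHS](bigD1 (kap j))//= upd_same eqxx/=.
rewrite mulrA -exprD; congr (_ * _); apply: eq_bigr => c cj.
by rewrite upd_other// eq_sym (negbTE cj).
Qed.

Lemma switch_weight_upd (J : finType) (kap : J -> C) sg l Sg j a :
  j \notin l -> switch_weight kap sg l (upd Sg j a) = switch_weight kap sg l Sg.
Proof.
elim: l sg => //= i l IHl sg; rewrite inE negb_or => /andP[ji jl].
by rewrite upd_other 1?eq_sym// IHl.
Qed.

(** At each position one rule continues its context for free and the others cost [y], in total at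
    most [1 + N * y]. The powers of [N] account for the coordinates outside [l] without a
    division. *)
Lemma sum_switch_weight_le (J : finType) (kap : J -> C) sg (l : seq J) : uniq l ->
  N ^+ size l * \sum_Sg switch_weight kap sg l Sg <=
  N ^+ #|J| * (1 + N * y) ^+ size l.
Proof.
have B0 : 0 <= 1 + N * y by rewrite addr_ge0 ?mulr_ge0.
elim: l sg => [|j l IHl] sg /=.
  by rewrite sumr_const !expr0 mul1r mulr1 -natrX -card_ffun.
move=> /andP[jl ul].
have e : N * \sum_Sg switch_weight kap sg (j :: l) Sg =
    \sum_(a : S) y ^+ (sg (kap j) != a) *
      \sum_Sg switch_weight kap (upd sg (kap j) a) l Sg.
  have := @sum_prod_upd J S R (fun _ _ => 1) j (switch_weight kap sg (j :: l)).
  rewrite sumr_const => /esym e.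
  rewrite (eq_bigr (fun Sg => \prod_(i : J) 1 * switch_weight kap sg (j :: l) Sg)).
    rewrite e; under [RHS]eq_bigr do rewrite mulr_sumr.
    rewrite [RHS]exchange_big/=; apply: eq_bigr => Sg _.
    rewrite big1// mul1r; apply: eq_bigr => a _.
    by rewrite upd_same switch_weight_upd// mul1r.
  by move=> Sg _; rewrite big1// mul1r.
rewrite exprSr -mulrA e mulr_sumr.
under eq_bigr do rewrite mulrCA.
apply: le_trans (_ : \sum_(a : S) y ^+ (sg (kap j) != a) *
   (N ^+ #|J| * (1 + N * y) ^+ size l) <= _).
  by apply: ler_sum => a _; rewrite ler_wpM2l ?exprn_ge0// IHl.
rewrite -mulr_suml mulrC exprSr mulrA ler_wpM2l ?mulr_ge0 ?exprn_ge0//.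
rewrite (bigD1 (sg (kap j)))//= eqxx expr0 lerD2l.
apply: le_trans (_ : \sum_(a : S) y <= _).
  rewrite [leRHS](bigD1 (sg (kap j)))//= -[leLHS]add0r lerD//.
  by apply: ler_sum => a /negbTE; rewrite eq_sym => ->.
by rewrite sumr_const mulr_natl.
Qed.

(** The first rule in a context is not charged; summing over all initial states [sg] pays for it
    with [N ^+ #|C|]. *)
Lemma sum_prod_nswitch_le (J : finType) (kap : J -> C) : (0 < #|S|)%N ->
  \sum_(Sg : {ffun J -> S})
    \prod_c y ^+ nswitch [seq Sg j | j <- enum J & kap j == c] <=
  N ^+ #|C| * (1 + N * y) ^+ #|J|.
Proof.
move=> N0.
have le_from (s : seq S) : y ^+ nswitch s <= \sum_a y ^+ nswitch_from a s.
  case/card_gt0P: N0 => a0 _; case: s => [|a s].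
    by rewrite (bigD1 a0)//= lerDl sumr_ge0// => a _; rewrite exprn_ge0.
  rewrite (bigD1 a)//= [nswitch_from a _]/nswitch_from/= eqxx lerDl sumr_ge0// => b _.
  by rewrite exprn_ge0.
apply: le_trans (_ : \sum_(Sg : {ffun J -> S}) \sum_(sg : {ffun C -> S})
    switch_weight kap sg (enum J) Sg <= _).
  apply: ler_sum => Sg _.
  under [leRHS]eq_bigr do rewrite switch_weightE.
  rewrite -(bigA_distr_bigA (fun c a =>
    y ^+ nswitch_from a [seq Sg j | j <- enum J & kap j == c])).
  by apply: ler_prod => c _; rewrite exprn_ge0//= le_from.
rewrite exchange_big/= -natrX -card_ffun mulr_natl -sumr_const.
apply: ler_sum => sg _.
have := sum_switch_weight_le kap sg (enum_uniq J).
by rewrite -cardE ler_pM2l// exprn_gt0// ltr0n.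
Qed.
End Switches.

(** * Tail bound for one block of independent coordinates *)

Section BlockTail.
Variables (R : realType) (I Z Xh C J : finType).
Local Notation S := {ffun Z -> Xh}.
Local Notation N := (#|{ffun Z -> Xh}|%:R : R).

(* The contexts are constant along the block [tau], so conditionally on them the
   block is still independent; each competitor is charged [y] per switch, which
   replaces counting by a union bound with weights. *)
Lemma block_tail_le (mu : I -> Z -> R) (tau : J -> I)
    (kap : {ffun I -> Z} -> J -> C) (D : J -> Z -> S -> R)
    (y lam B a : R) (m : nat) (E : pred {ffun I -> Z}) :
  (forall i b, 0 <= mu i b) -> (forall i, \sum_b mu i b = 1) -> injective tau ->
  (forall z j b, kap (upd z (tau j) b) =1 kap z) ->
  (forall j s, \sum_b mu (tau j) b * expR (lam * D j b s) <= B) ->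
  (0 < #|{ffun Z -> Xh}|)%N -> 0 <= y <= 1 -> 0 <= lam -> 0 <= B ->
  (forall z, E z -> exists2 Sg : {ffun J -> S},
     forall c, (nswitch [seq Sg j | j <- enum J & kap z j == c] <= m)%N &
     a < \sum_j D j (z (tau j)) (Sg j)) ->
  y ^+ (m * #|C|) * \sum_(z | E z) \prod_i mu i (z i) <=
  expR (- (lam * a)) * B ^+ #|J| * (N ^+ #|C| * (1 + N * y) ^+ #|J|).
Proof.
move=> mu0 mu1 tau_inj kap_upd DB N0 /andP[y0 y1] lam0 B0 HE.
have w0 (z : {ffun I -> Z}) : 0 <= \prod_i mu i (z i) by apply: prodr_ge0.
pose g (Sg : {ffun J -> S}) z :=
  \prod_(c : C) y ^+ nswitch [seq Sg j | j <- enum J & kap z j == c].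
have g0 Sg z : 0 <= g Sg z by apply: prodr_ge0 => c _; rewrite exprn_ge0.
have g_upd Sg z j b : g Sg (upd z (tau j) b) = g Sg z.
  apply: eq_bigr => c _; congr (_ ^+ nswitch (map _ _)).
  by apply: eq_filter => i; rewrite kap_upd.
pose phi (Sg : {ffun J -> S}) j b := expR (lam * D j b (Sg j)).
(* Exponential Markov bound: the term of the witness [Sg] suffices, as its deviation makes the
   exponential factor at least 1 and [y <= 1] makes its weight at least [y ^+ m] per context. *)
have markov z : E z -> y ^+ (m * #|C|) <=
    expR (- (lam * a)) * \sum_Sg g Sg z * \prod_j phi Sg j (z (tau j)).
  move=> /HE[Sg adm aD]; rewrite (bigD1 Sg)//= mulrDr -[leLHS]addr0 lerD//.
    rewrite mulrCA -expR_sum -mulr_sumr -expRD -[leLHS]mulr1.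
    apply: ler_pM; rewrite ?exprn_ge0//.
      rewrite exprM -prodr_const; apply: ler_prod => c _.
      by rewrite !exprn_ge0//= ler_wiXn2l.
    by rewrite -expR0 ler_expR addrC subr_ge0 ler_wpM2l// ltW.
  rewrite mulr_ge0 ?expR_ge0// sumr_ge0// => Sg' _.
  by rewrite mulr_ge0// prodr_ge0// => j _; rewrite expR_ge0.
have mean_g : \sum_Sg \sum_(z : {ffun I -> Z}) (\prod_i mu i (z i)) * g Sg z <=
    N ^+ #|C| * (1 + N * y) ^+ #|J|.
  set K := leRHS.
  have w1 : \sum_(z : {ffun I -> Z}) \prod_i mu i (z i) = 1.
    by rewrite -(bigA_distr_bigA mu) big1.
  rewrite exchange_big/= -[K]mul1r -[X in X * K]w1 mulr_suml; apply: ler_sum => z _.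
  by rewrite -mulr_sumr ler_wpM2l// sum_prod_nswitch_le.
rewrite -mulrA; apply: le_trans (ler_wpM2l (expR_ge0 _) (ler_wpM2l (exprn_ge0 _ B0) mean_g)).
apply: le_trans (_ : \sum_(z : {ffun I -> Z}) (\prod_i mu i (z i)) *
   (expR (- (lam * a)) * \sum_Sg g Sg z * \prod_j phi Sg j (z (tau j))) <= _).
  rewrite mulr_sumr big_mkcond/=; apply: ler_sum => z _.
  case: ifPn => [/markov Ez|_]; first by rewrite mulrC ler_wpM2l.
  rewrite !mulr_ge0 ?expR_ge0// sumr_ge0// => Sg _.
  by rewrite mulr_ge0// prodr_ge0// => j _; rewrite expR_ge0.
under eq_bigr do rewrite mulrCA mulr_sumr.
rewrite -mulr_sumr ler_wpM2l ?expR_ge0// exchange_big/= mulr_sumr.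
apply: ler_sum => Sg _.
have := @sum_prod_indep_le I Z R mu J tau (phi Sg) (g Sg) B (enum J) mu0 mu1
  tau_inj (fun _ _ => expR_ge0 _) (fun j => DB j (Sg j)) (g0 Sg) (g_upd Sg) (enum_uniq J).
rewrite -cardE; apply: le_trans; rewrite le_eqVlt; apply/orP; left; apply/eqP.
by apply: eq_bigr => z _; rewrite big_enum.
Qed.
End BlockTail.

(** * Binary entropy and the switch weight *)

Lemma hb_ge0 (R : realType) (p : R) : 0 <= p <= 1 -> 0 <= hb p.
Proof.
move=> /andP[p0 p1]; rewrite /hb addr_ge0 ?mulNr ?oppr_ge0//.
  by rewrite mulr_ge0_le0// ln_le0.
by rewrite mulr_ge0_le0 ?subr_ge0// ln_le0// lerBlDr lerDl.
Qed.

Lemma expR_hb (R : realType) (T m : nat) (p := m%:R / T%:R : R) :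
  (0 < T)%N -> (m < T)%N ->
  expR (T%:R * hb p) * (p / (1 - p)) ^+ m = (1 - p)^-1 ^+ T.
Proof.
move=> T0 mT.
have TR : 0 < T%:R :> R by rewrite ltr0n.
have p1 : 0 < 1 - p by rewrite subr_gt0 ltr_pdivrMr ?mul1r ?ltr_nat.
have -> : T%:R * hb p = - (m%:R * ln p) - (T%:R - m%:R) * ln (1 - p).
  by rewrite /hb /p; field; exact: lt0r_neq0.
(* For [m = 0] also [p = 0], where [ln p] is a default value and [lnK] does not apply. *)
case: (posnP m) => [m0|m0].
  rewrite m0 mulr0n !mul0r oppr0 add0r addr0 expr0 mulr1 -mulrN expRM_natl expRN.
  by rewrite lnK.
have p0 : 0 < p by rewrite divr_gt0 ?ltr0n.
rewrite -natrB 1?ltnW// expRD !expRN !expRM_natl !lnK//.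
clearbody p; rewrite exprMn mulrACA mulVf ?expf_neq0 ?lt0r_neq0// mul1r -exprVn.
by rewrite -exprD subnK 1?ltnW.
Qed.

(* The weight [y] per switch that optimises the union bound. *)
Lemma switch_count_le (R : realType) (N T J C m : nat)
    (p := m%:R / T%:R : R) (y := p / (1 - p) / N%:R) :
  (0 < N)%N -> (0 < C)%N -> (0 < T)%N -> (J <= T)%N -> (m < T)%N ->
  N%:R ^+ C * (1 + N%:R * y) ^+ J <=
  y ^+ (m * C) * expR (C%:R * (T%:R * hb p + m.+1%:R * ln N%:R)).
Proof.
move=> N0 C0 T0 JT mT.
have NR : 0 < N%:R :> R by rewrite ltr0n.
have NN0 := lt0r_neq0 NR.
have p0 : 0 <= p by rewrite divr_ge0.
have p1 : 0 < 1 - p by rewrite subr_gt0 ltr_pdivrMr ?ltr0n// mul1r ltr_nat.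
have -> : 1 + N%:R * y = (1 - p)^-1.
  by rewrite /y; field; rewrite NN0 lt0r_neq0.
have -> : y ^+ (m * C) * expR (C%:R * (T%:R * hb p + m.+1%:R * ln N%:R)) =
    (N%:R * (1 - p)^-1 ^+ T) ^+ C.
  rewrite exprM expRM_natl -exprMn -(expR_hb R T0 mT) -/p expRD.
  rewrite [expR (m.+1%:R * _)]expRM_natl lnK//.
  congr (_ ^+ _); rewrite /y exprMn exprS exprVn; field.
  by rewrite expf_neq0//= lt0r_neq0.
(* Since [(1 - p)^-1] is at least 1, the exponent [J] may be raised to [T * C]. *)
rewrite exprMn ler_wpM2l ?exprn_ge0// -exprM ler_weXn2l//.
  by rewrite invf_ge1// lerBlDr lerDl.
by rewrite (leq_trans JT)// leq_pmulr.
Qed.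

(** * Contexts within a residue class *)

Lemma val_enum_sig (T : finType) (A : {pred T}) :
  [seq val u | u <- enum {: {x | x \in A}}] = enum A.
Proof.
rewrite enumT unlock /= pmap_filter; last exact: insubK.
by apply: eq_filter => x; exact: isSome_insub.
Qed.

(** The context of [j] uses positions at distance 1 to [k] from [pos j], whereas positions of one
    residue class coincide or are at least [k + 1] apart. *)
Lemma ctx_upd (Z : finType) (n k : nat) (z : {ffun 'I_n -> Z})
    (j j' : 'I_(n - 2 * k)) b :
  (j %% k.+1 = j' %% k.+1)%N -> ctx (upd z (pos j') b) j = ctx z j.
Proof.
move=> jj'; apply/ffunP => i; rewrite [LHS]ffunE [RHS]ffunE upd_other//.
apply/eqP => /(congr1 val) /=.
have := ltn_ord i; rewrite (divn_eq j k.+1) (divn_eq j' k.+1) jj'.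
set q := (j %/ _)%N; set q' := (j' %/ _)%N; set r := (j' %% _)%N => ik e.
have {}e : (q * k.+1 + i + (k <= i) = k + q' * k.+1)%N.
  by move: e; lia.
case: (ltngtP q q') => qq.
- have : (k.+1 + q * k.+1 <= q' * k.+1)%N by rewrite -mulSn leq_mul2r qq orbT.
  by move: e ik; case: leqP => /=; lia.
- have : (k.+1 + q' * k.+1 <= q * k.+1)%N by rewrite -mulSn leq_mul2r qq orbT.
  by move: e ik; case: leqP => /=; lia.
- by move: e; rewrite qq; case: leqP => /=; lia.
Qed.

(** * Estimated loss versus true loss *)

Section Loss.
Variables (R : realType) (X Z Xh : finType).
Variables (Pi : X -> Z -> R) (Lam : X -> Xh -> R) (H : Z -> X -> R).
Hypothesis HH : forall x x', \sum_z Pi x z * H z x' = (x == x')%:R.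

Definition loss_gap (x : X) (z : Z) (s : {ffun Z -> Xh}) : R :=
  Lam x (s z) - ell Pi Lam H z s.

(** Both terms have mean [rho Pi Lam x s], the estimate because [H] is a right inverse of [Pi]. *)
Lemma loss_gap_mean x s : \sum_z Pi x z * loss_gap x z s = 0.
Proof.
under eq_bigr do rewrite mulrBr.
rewrite sumrB; apply/eqP; rewrite subr_eq0; apply/eqP.
transitivity (rho Pi Lam x s); first by apply: eq_bigr => z _; rewrite mulrC.
under [RHS]eq_bigr do rewrite mulr_sumr.
rewrite exchange_big/= [RHS](eq_bigr (fun x' => (x == x')%:R * rho Pi Lam x' s)).
  rewrite (bigD1 x)//= eqxx mul1r big1 ?addr0// => x' /negbTE.
  by rewrite eq_sym => ->; rewrite mul0r.
by move=> x' _; rewrite -HH mulr_suml; apply: eq_bigr => z _; rewrite mulrA.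
Qed.

Lemma loss_gap_range x z z' s : (forall x xh, 0 <= Lam x xh) ->
  loss_gap x z s - loss_gap x z' s <= L_max Pi Lam H.
Proof.
move=> Lam0; rewrite /loss_gap /L_max.
have l1 : Lam x (s z) <= Lam_max Lam by apply: (le_bigmax _ _ (x, s z)).
have l2 : ell Pi Lam H z' s - ell Pi Lam H z s <= ell_max Pi Lam H.
  exact: (le_bigmax _ (fun p : (Z * {ffun Z -> Xh}) * (Z * {ffun Z -> Xh}) =>
    ell Pi Lam H p.1.1 p.1.2 - ell Pi Lam H p.2.1 p.2.2) ((z', s), (z, s))).
by have := Lam0 x (s z'); lra.
Qed.

Lemma L_max_ge0 : 0 <= L_max Pi Lam H.
Proof. by rewrite addr_ge0// bigmax_ge_id. Qed.

Lemma Lhat_le_Lam_max (n k : nat) (x : 'I_n -> X) (z : {ffun 'I_n -> Z})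
    (Sg : {ffun 'I_(n - 2 * k) -> {ffun Z -> Xh}}) :
  Lhat Lam (k := k) x z Sg <= Lam_max Lam.
Proof.
have M0 : 0 <= Lam_max Lam by rewrite bigmax_ge_id.
rewrite /Lhat; have [T0|T0] := posnP (n - 2 * k).
  by rewrite [X in X%:R^-1]T0 invr0 mul0r.
rewrite mulrC ler_pdivrMr ?ltr0n//.
apply: le_trans (_ : \sum_(j < n - 2 * k) Lam_max Lam <= _); last first.
  by rewrite sumr_const card_ord mulr_natr.
by apply: ler_sum => j _; apply: (le_bigmax _ _ (x (pos j), Sg j (z (pos j)))).
Qed.

Lemma LhatB_Ltil (n k : nat) (x : 'I_n -> X) (z : {ffun 'I_n -> Z})
    (Sg : {ffun 'I_(n - 2 * k) -> {ffun Z -> Xh}}) :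
  Lhat Lam (k := k) x z Sg - Ltil Pi Lam H (k := k) z Sg =
  (n - 2 * k)%N%:R^-1 * \sum_j loss_gap (x (pos j)) (z (pos j)) (Sg j).
Proof. by rewrite -mulrBr sumrB. Qed.

(** The default [Lam_max] dominates every [Lhat], so a minimum below [Lhat x z Sh - eps] must come
    from an admissible tuple. *)
Lemma Dkm_lt (n k m : nat) (x : 'I_n -> X) (z : {ffun 'I_n -> Z})
    (Sh : {ffun 'I_(n - 2 * k) -> {ffun Z -> Xh}}) eps :
  0 < eps -> eps < Lhat Lam (k := k) x z Sh - Dkm Lam k m x z ->
  exists2 Sg, admissible (k := k) m z Sg &
    eps < Lhat Lam (k := k) x z Sh - Lhat Lam (k := k) x z Sg.
Proof.
move=> eps0 lt_eps; case: (pickP (fun Sg => admissible (k := k) m z Sg &&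
    (eps < Lhat Lam (k := k) x z Sh - Lhat Lam (k := k) x z Sg))) => [Sg /andP[]|none].
  by exists Sg.
suff : Lhat Lam (k := k) x z Sh - eps <= Dkm Lam k m x z by lra.
apply: le_bigmin; first by have := Lhat_le_Lam_max x z Sh; lra.
by move=> Sg adm; have := none Sg; rewrite adm/= => /negbT; rewrite -leNgt; lra.
Qed.
End Loss.

(** * Partition of the positions into residue classes *)

Section Blocks.
Variables (k T : nat).

Definition block (i : 'I_k.+1) : {pred 'I_T} := [pred j : 'I_T | (j %% k.+1 == i)%N].

Lemma big_block (R : Type) (idx : R) (op : Monoid.com_law idx) (F : 'I_T -> R) :
  \big[op/idx]_j F j =
  \big[op/idx]_(i < k.+1) \big[op/idx]_(j : {j | j \in block i}) F (val j).
Proof.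
rewrite (partition_big (fun j : 'I_T => inord (j %% k.+1) : 'I_k.+1) xpredT)//=.
apply: eq_bigr => i _; rewrite -(big_sub (block i)); apply: eq_bigl => j.
by rewrite inE -val_eqE/= inordK ?ltn_pmod.
Qed.
End Blocks.

(** * Deviation within one residue class *)

Section Concentration.
Variables (R : realType) (X Z Xh : finType).
Variables (Pi : X -> Z -> R) (Lam : X -> Xh -> R) (H : Z -> X -> R) (k n m : nat).
Hypothesis HPi0 : forall x z, 0 <= Pi x z.
Hypothesis HPi1 : forall x, \sum_z Pi x z = 1.
Hypothesis HH : forall x x', \sum_z Pi x z * H z x' = (x == x')%:R.
Hypothesis HLam : forall x xh, 0 <= Lam x xh.
Variables (eps : R) (x : 'I_n -> X).
Hypotheses (eps_gt0 : 0 < eps) (T_gt0 : (0 < n - 2 * k)%N) (m_lt : (2 * m <= n - 2 * k)%N).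
Hypotheses (N_gt0 : (0 < #|{ffun Z -> Xh}|)%N) (Z_gt0 : (0 < #|Z|)%N).
Hypothesis L_gt0 : 0 < L_max Pi Lam H.
Local Notation T := (n - 2 * k)%N.
Local Notation L := (L_max Pi Lam H).
Local Notation N := #|{ffun Z -> Xh}|.
Local Notation gap b z Sg j :=
  ((-1) ^+ b * loss_gap Pi Lam H (x (pos j)) (z (pos j)) (Sg j)).

(* Any thresholds adding up to [T * eps / 2] would do for the union bound; AM-GM makes
   these ones satisfy [threshold i ^+ 2 >= eps ^+ 2 / 4 * T / k.+1 * #|block i|]. *)
Definition threshold (i : 'I_k.+1) : R :=
  eps / 4 * (T%:R / k.+1%:R + #|@block k T i|%:R).

Lemma sum_threshold : \sum_i threshold i = T%:R * (eps / 2).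
Proof.
rewrite -mulr_sumr big_split/= sumr_const card_ord -natr_sum.
have -> : (\sum_i #|@block k T i| = T)%N.
  transitivity (\sum_(j < T) 1)%N; last by rewrite sum1_card card_ord.
  by rewrite [RHS](big_block k); apply: eq_bigr => i _; rewrite sum1_card card_sig.
by rewrite -[_ / _ *+ _]mulr_natr divfK ?pnatr_eq0//; lra.
Qed.

(** The Boolean is the direction of the error: [false] when the true loss exceeds its estimate,
    [true] for the opposite. *)
Definition block_event (p : 'I_k.+1 * bool) : pred {ffun 'I_n -> Z} :=
  [pred z | [exists Sg, admissible (k := k) m z Sg &&
    (threshold p.1 < \sum_(j : {j | j \in block p.1}) gap p.2 z Sg (val j))]].

(** Combines [block_tail_le] at the optimal [lam] with [switch_count_le]; the choice of [threshold]
    makes the bound free of the class size. *)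
Lemma Pr_block_event_le p :
  Pr Pi x (block_event p) <=
  expR (- (T%:R * (eps ^+ 2 / (2 * k.+1%:R * L ^+ 2)))) *
  expR ((#|Z| ^ (2 * k))%N%:R * (T%:R * hb (m%:R / T%:R) + m.+1%:R * ln N%:R)).
Proof.
case: p => i b; set a := threshold i.
pose J : finType := {j : 'I_T | j \in block i}.
have cardJ : #|J| = #|@block k T i| by rewrite card_sig.
have a_gt0 : 0 < a by rewrite mulr_gt0 ?divr_gt0// ltr_wpDr// divr_gt0 ?ltr0n.
(* In an empty class the sum is 0, below the positive threshold. *)
have [J0|J0] := posnP #|J|.
  rewrite /Pr big_pred0 ?mulr_ge0 ?expR_ge0// => z; apply/negbTE/existsPn => Sg.
  rewrite negb_and -leNgt big_pred0 ?ltW ?orbT// => j.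
  by have := card0_eq J0 j; rewrite inE.
have JR : 0 < #|J|%:R :> R by rewrite ltr0n.
have TR : 0 < T%:R :> R by rewrite ltr0n.
have mT : (m < T)%N by lia.
pose prob : R := m%:R / T%:R; pose y := prob / (1 - prob) / N%:R.
have prob0 : 0 <= prob by rewrite divr_ge0.
(* Here [2 * m <= T] enters: the odds [prob / (1 - prob)] are then at most 1, which gives
   [y <= 1]. *)
have prob2 : prob <= 1 / 2.
  rewrite ler_pdivrMr// mulrAC ler_pdivlMr// mul1r mulrC -natrM ler_nat//.
have prob1 : 0 < 1 - prob by lra.
have NR : 0 < N%:R :> R by rewrite ltr0n.
have y01 : 0 <= y <= 1.
  have y0 : 0 <= prob / (1 - prob) by rewrite divr_ge0// subr_ge0; lra.
  rewrite divr_ge0//= ler_pdivrMr ?ltr0n// mul1r.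
  apply: le_trans (_ : 1 <= _); last by rewrite ler1n.
  by rewrite ler_pdivrMr ?mul1r; lra.
(* The minimiser of [#|J| * lam ^+ 2 * L ^+ 2 / 8 - lam * a]. *)
pose lam := 4 * a / (#|J|%:R * L ^+ 2).
have lam0 : 0 <= lam.
  by rewrite divr_ge0 ?(mulr_ge0 _ (ltW a_gt0))// mulr_ge0 ?sqr_ge0.
pose B := expR (lam ^+ 2 * L ^+ 2 / 8).
have tail := @block_tail_le R 'I_n Z Xh {ffun 'I_(2 * k) -> Z} J
  (fun t => Pi (x t)) (fun j => pos (val j)) (fun z j => ctx z (val j))
  (fun j c s => (-1) ^+ b * loss_gap Pi Lam H (x (pos (val j))) c s)
  y lam B a m (block_event (i, b)).
have {}tail : y ^+ (m * #|{ffun 'I_(2 * k) -> Z}|) * Pr Pi x (block_event (i, b)) <=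
    expR (- (lam * a)) * B ^+ #|J| *
    (N%:R ^+ #|{ffun 'I_(2 * k) -> Z}| * (1 + N%:R * y) ^+ #|J|).
  apply: tail => //.
  - move=> j j' /(congr1 val)/= e; exact/val_inj/val_inj/(addnI e).
  - move=> z j c j'; apply: ctx_upd.
    by have := valP j; have := valP j'; rewrite !inE => /eqP -> /eqP ->.
  - move=> j s; apply: hoeffding_mgf_le => //.
      under eq_bigr do rewrite mulrCA.
      by rewrite -mulr_sumr loss_gap_mean// mulr0.
    move=> c c'; rewrite -mulrBr.
    have := loss_gap_range Pi H (x (pos (val j))) c c' s HLam.
    have := loss_gap_range Pi H (x (pos (val j))) c' c s HLam.
    by case: (b); rewrite /= ?expr1 ?expr0; lra.
  - exact: expR_ge0.
  (* The competitor is restricted to the class, where its rules in each context form a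
     subsequence. *)
  - move=> z /existsP[Sg /andP[/forallP adm dev]].
    exists [ffun j => Sg (val j)]; last first.
      by under eq_bigr do rewrite ffunE.
    move=> c; apply: leq_trans (adm c).
    apply: nswitch_subseq.
    rewrite (eq_map (g := Sg \o val)); last by move=> j; rewrite ffunE.
    rewrite map_comp; apply: map_subseq.
    rewrite -(filter_map val (fun j => ctx z j == c)) val_enum_sig subseq_filter filter_all /=.
    apply: subseq_trans (filter_subseq _ _) _.
    by rewrite [X in subseq _ X]enumT; exact: filter_subseq.
have exponent : expR (- (lam * a)) * B ^+ #|J| <=
    expR (- (T%:R * (eps ^+ 2 / (2 * k.+1%:R * L ^+ 2)))).
  rewrite -expRM_natl -expRD ler_expR.
  have -> : - (lam * a) + #|J|%:R * (lam ^+ 2 * L ^+ 2 / 8) =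
      - (2 * a ^+ 2 / (#|J|%:R * L ^+ 2)).
    by rewrite /lam; field; rewrite !lt0r_neq0.
  rewrite lerN2 -subr_ge0.
  have -> : 2 * a ^+ 2 / (#|J|%:R * L ^+ 2) -
      T%:R * (eps ^+ 2 / (2 * k.+1%:R * L ^+ 2)) =
      eps ^+ 2 * (T%:R / k.+1%:R - #|J|%:R) ^+ 2 / (8 * (#|J|%:R * L ^+ 2)).
    have K0 : 0 < k.+1%:R :> R by rewrite ltr0n.
    rewrite /a /threshold -cardJ; move: (k.+1%:R : R) K0 => K K0.
    by field; rewrite !lt0r_neq0.
  apply: divr_ge0; first exact: mulr_ge0 (sqr_ge0 _) (sqr_ge0 _).
  by apply: mulr_ge0 => //; exact: mulr_ge0 (ltW JR) (sqr_ge0 _).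
have C_gt0 : (0 < #|{ffun 'I_(2 * k) -> Z}|)%N by rewrite card_ffun expn_gt0 Z_gt0.
have JT : (#|J| <= T)%N by rewrite cardJ (leq_trans (max_card _))// card_ord.
have count := switch_count_le R N_gt0 C_gt0 T_gt0 JT mT.
rewrite -/prob -/y in count.
have ym_gt0 : 0 < y ^+ (m * #|{ffun 'I_(2 * k) -> Z}|).
  (* For [m = 0] the weight [y] is 0, and positivity rests on [0 ^+ 0 = 1]. *)
  have [->|m_gt0] := posnP m; first by rewrite mul0n expr0.
  have prob_gt0 : 0 < prob by rewrite divr_gt0 ?ltr0n.
  exact: exprn_gt0 (divr_gt0 (divr_gt0 prob_gt0 prob1) NR).
rewrite -(ler_pM2l ym_gt0); apply: le_trans tail _.
have cardC : #|{ffun 'I_(2 * k) -> Z}| = (#|Z| ^ (2 * k))%N.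
  by rewrite card_ffun card_ord.
rewrite [leRHS]mulrCA -cardC.
have [y0 _] := andP y01; apply: (ler_pM _ _ exponent count).
  exact: mulr_ge0 (expR_ge0 _) (exprn_ge0 _ (expR_ge0 _)).
by rewrite mulr_ge0// exprn_ge0// addr_ge0// mulr_ge0.
Qed.

(** The thresholds add up to [T * (eps / 2)], so some class sum exceeds its own. *)
Lemma admissible_block_event (z : {ffun 'I_n -> Z}) Sg (b : bool) :
  admissible (k := k) m z Sg -> T%:R * (eps / 2) < \sum_j gap b z Sg j ->
  exists p, block_event p z.
Proof.
move=> adm; rewrite (big_block k) -sum_threshold => dev.
case: (pickP (fun i => block_event (i, b) z)) => [i Ei|none]; first by exists (i, b).
move: dev; rewrite ltNge => /negP[]; apply: ler_sum => i _.
rewrite leNgt; apply/negP => lt_i; move: (none i) => /negbT/existsPn/(_ Sg).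
by rewrite adm/= lt_i.
Qed.

End Concentration.

(** * Union bound over classes and directions *)

Theorem theorem3 (R : realType) (X Z Xh : finType)
  (Pi : X -> Z -> R) (Lam : X -> Xh -> R) (H : Z -> X -> R) (k n m : nat)
  (HPi0 : forall x z, 0 <= Pi x z) (HPi1 : forall x, \sum_z Pi x z = 1)
  (HH : forall x x', \sum_z Pi x z * H z x' = (x == x')%:R)
  (HLam : forall x xh, 0 <= Lam x xh)
  (Hn : (2 * k < n)%N) (Hm : (m <= (n - 2 * k)./2)%N)
  (Shat : {ffun 'I_n -> Z} -> {ffun 'I_(n - 2 * k) -> {ffun Z -> Xh}})
  (HS1 : forall z, admissible (k:=k) m z (Shat z))
  (HS2 : forall z Sg, admissible (k:=k) m z Sg ->
           Ltil Pi Lam H (k:=k) z (Shat z) <= Ltil Pi Lam H (k:=k) z Sg)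
  (eps : R) (Heps : 0 < eps) (x : 'I_n -> X) :
  Pr Pi x [pred z | Lhat Lam (k:=k) x z (Shat z) - Dkm Lam k m x z > eps]
  <= 2 * (k.+1)%:R *
     expR (- ((n - 2 * k)%N%:R *
        (eps ^+ 2 / (2 * (k.+1)%:R * (L_max Pi Lam H) ^+ 2)
         - 2 * (#|Z|%:R) ^+ (2 * k) *
           (hb (m%:R / (n - 2 * k)%N%:R)
            + (m.+1)%:R * ln (#|{ffun Z -> Xh}|%:R) / (n - 2 * k)%N%:R)))).
Proof.
have T_gt0 : (0 < n - 2 * k)%N by rewrite subn_gt0.
have mT : (2 * m <= n - 2 * k)%N by lia.
set E := [pred z | _].
have [z0 _|noz] := pickP {ffun 'I_n -> Z}; last first.
  by rewrite /Pr big_pred0 ?mulr_ge0 ?expR_ge0// => z; have := noz z; rewrite inE.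
have Z_gt0 : (0 < #|Z|)%N.
  by apply/card_gt0P; exists (z0 (Ordinal (leq_ltn_trans (leq0n _) Hn))).
have N_gt0 : (0 < #|{ffun Z -> Xh}|)%N.
  by apply/card_gt0P; exists (Shat z0 (Ordinal T_gt0)).
set T := (n - 2 * k)%N%:R; set gain := eps ^+ 2 / _.
set N := #|{ffun Z -> Xh}|%:R; set C := #|Z|%:R ^+ _.
have TR : 0 < T by rewrite ltr0n.
pose Q : R := T * hb (m%:R / T) + m.+1%:R * ln N.
have Q_ge0 : 0 <= Q.
  rewrite addr_ge0 ?mulr_ge0 ?ln_ge0 ?ler1n ?(ltW TR)// hb_ge0//.
  by rewrite divr_ge0 ?(ltW TR)//= ler_pdivrMr// mul1r ler_nat; lia.
have C_ge0 : 0 <= C by rewrite exprn_ge0.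
have -> : - (T * (gain - 2 * C * (hb (m%:R / T) + m.+1%:R * ln N / T))) =
    - (T * gain) + (C * Q + C * Q).
  by rewrite /Q; field; exact: lt0r_neq0.
have w0 (z : {ffun 'I_n -> Z}) : 0 <= \prod_(t < n) Pi (x t) (z t).
  by apply: prodr_ge0.
have [L0|LN0] := eqVneq (L_max Pi Lam H) 0.
  (* Division by [L_max ^+ 2 = 0] yields [0], so the bound exceeds 1. *)
  apply: le_trans (_ : 1 <= _).
    have <- : \sum_(z : {ffun 'I_n -> Z}) \prod_(t < n) Pi (x t) (z t) = 1.
      by rewrite -(bigA_distr_bigA (fun t => Pi (x t))) big1.
    by rewrite /Pr big_mkcond; apply: ler_sum => z _; case: ifP.
  rewrite -[leLHS]mul1r ler_pM//.
    by rewrite -natrM ler1n.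
  have -> : gain = 0 by rewrite /gain L0 expr0n mulr0 invr0 mulr0.
  rewrite mulr0 oppr0 add0r; apply: le_trans (expR_ge1Dx _).
  by rewrite lerDl addr_ge0 ?mulr_ge0.
have L_gt0 : 0 < L_max Pi Lam H by rewrite lt_neqAle eq_sym LN0 L_max_ge0.
have union : Pr Pi x E <=
    \sum_p Pr Pi x (block_event Pi Lam H (k := k) m eps x p).
  rewrite /Pr; under [leRHS]eq_bigr do rewrite big_mkcond.
  rewrite exchange_big/= big_mkcond; apply: ler_sum => z _.
  have pos_if p : 0 <= (if block_event Pi Lam H (k := k) m eps x p z
      then \prod_(t < n) Pi (x t) (z t) else 0) by case: ifP.
  case: ifP => [Ez|_]; last by apply: sumr_ge0.
  suff [p Ep] : exists p, block_event Pi Lam H (k := k) m eps x p z.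
    by rewrite (bigD1 p)//= Ep lerDl sumr_ge0.
  have [Sg adm far] := Dkm_lt Heps Ez.
  have := LhatB_Ltil Pi Lam H x z (Shat z).
  have := LhatB_Ltil Pi Lam H x z Sg.
  rewrite -/T; set gS := \sum_j _; set gH := \sum_j _ => eS eH.
  (* Minimality of [Shat z] for the estimated loss leaves only the gap sums, so [gH] or [- gS]
     exceeds [T * (eps / 2)]. *)
  have dev : T * eps < gH - gS.
    rewrite mulrC -ltr_pdivlMr// [ltRHS]mulrC mulrBr -eS -eH.
    by have := HS2 z Sg adm; lra.
  have [dH|dH] := ltP (T * (eps / 2)) gH.
    apply: (admissible_block_event (Sg := Shat z) (b := false)) => //.
    by under eq_bigr do rewrite expr0 mul1r.
  apply: (admissible_block_event (Sg := Sg) (b := true)) => //.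
  under eq_bigr do rewrite expr1 mulN1r.
  by rewrite sumrN -/gS -/T; lra.
apply: le_trans union _.
apply: le_trans (_ : \sum_(p : 'I_k.+1 * bool) expR (- (T * gain)) * expR (C * Q) <= _).
  apply: ler_sum => p _; have := @Pr_block_event_le R X Z Xh Pi Lam H k n m
    HPi0 HPi1 HH HLam eps x Heps T_gt0 mT N_gt0 Z_gt0 L_gt0 p.
  by rewrite natrX.
rewrite sumr_const card_prod card_ord card_bool -[leLHS]mulr_natl natrM.
(* Each class bound carries one [C * Q]; nonnegativity of [Q] supplies the second copy in the stated
   exponent. *)
rewrite [_ * 2]mulrC ler_wpM2l ?mulr_ge0// -expRD ler_expR lerD2l lerDl.
by rewrite mulr_ge0.
Qed.
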